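(* There is an absolute constant $c>0$ such that the following holds. Suppose that $d\ge 45$ is an integer, $p\in\big[1+\tfrac1{1+\log d},\,2\big]$, $q=\tfrac{p}{p-1}$, and $\sigma\ge \dfrac{10}{\sqrt q\, d^{1/q}}$. Then $$\sup_{\theta^\star\in\mathsf B^d_p}\mathbf E_{Y\sim\mathsf N(\theta^\star,\sigma^2I_d)}\big\|\Pi_{\mathsf B^d_p}(Y)-\theta^\star\big\|_2^2\;\ge\; c.$$ Moreover, the lower bound is attained at $\theta^\star=e_1$, i.e. $\mathbf E_{Y\sim\mathsf N(e_1,\sigma^2I_d)}\|\Pi_{\mathsf B^d_p}(Y)-e_1\|_2^2\ge c$.
   Context: $\mathsf{B}^d_p=\{x\in\mathbf{R}^d:\|x\|_p\le 1\}$ with $\|x\|_p=(\sum_i|x_i|^p)^{1/p}$; $\Pi_{\mathsf B^d_p}$ is the Euclidean projection onto $\mathsf B^d_p$ (the maximum likelihood estimator); $e_1$ is the first standard basis vector of $\mathbf R^d$; $\log$ is the natural logarithm. *)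

(* Defs.v *)
From HB Require Import structures.
From mathcomp Require Export all_boot all_order all_algebra.
From mathcomp Require Export all_classical all_reals all_analysis.
Export Order.TTheory GRing.Theory Num.Theory.
Export numFieldNormedType.Exports.

Set Implicit Arguments.
Unset Strict Implicit.
Unset Printing Implicit Defensive.

Local Open Scope classical_set_scope.
Local Open Scope ring_scope.

Section product_probability.
Context {R : realType} {disp : measure_display} {T : measurableType disp}.

Definition pair_cons n (x : T * n.-tuple T) : n.+1.-tuple T :=
  [tuple of x.1 :: x.2].

Let measurable_pair_cons n : measurable_fun [set: T * n.-tuple T] (@pair_cons n).
Proof. exact: measurable_cons. Qed.

HB.instance Definition _ n :=
  isMeasurableFun.Build _ _ _ _ (@pair_cons n) (@measurable_pair_cons n).

(* The product probability of P 0, ..., P (n - 1) on n-tuples; see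
   [prod_probabilityE] for its values on rectangles. *)
Fixpoint prod_probability n :
    ('I_n -> probability T R) -> probability (n.-tuple T) R :=
  match n with
  | 0 => fun _ => dirac [tuple]
  | n'.+1 => fun P => distribution
      (P ord0 \x prod_probability (fun i => P (lift ord0 i)))%E (@pair_cons n')
  end.

Lemma prod_probabilityE n (P : 'I_n -> probability T R) (A : 'I_n -> set T) :
  (forall i, measurable (A i)) ->
  prod_probability P [set x | forall i, A i (tnth x i)] =
  (\prod_(i < n) P i (A i))%E.
Proof.
have mrect m (B : 'I_m -> set T) : (forall i, measurable (B i)) ->
    measurable [set x : m.-tuple T | forall i, B i (tnth x i)].
  move=> mB.
  rewrite [X in measurable X](_ : _ =
      \bigcap_(i in [set: 'I_m]) ((@tnth m T ^~ i) @^-1` B i)); last first.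
    by apply/seteqP; split => x /= Bx i; [move=> _; exact: Bx | exact: Bx].
  apply: fin_bigcap_measurable => // i _.
  by rewrite -[X in measurable X]setTI; exact: measurable_tnth.
elim: n P A => [|n IHn] P A mA.
  rewrite big_ord0 /= diracE mem_set//= => -[].
  by [].
rewrite big_ord_recl -(IHn _ _ (fun i => mA (lift ord0 i))) /=.
rewrite -product_measure1E//; last first.
  by apply: (mrect _ (fun i => A (lift ord0 i))) => i; exact: mA.
rewrite /distribution /pushforward; congr (_ _).
apply/seteqP; split => -[x y] /=.
- move=> Axy; split; first by have := Axy ord0.
  by move=> i; have := Axy (lift ord0 i); rewrite tnthS.
- move=> [A0x Ay] i; have [j ->|->//] := unliftP ord0 i.
  by rewrite tnthS.
Qed.

End product_probability.

Section lp_ball.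
Context {R : realType} {d : nat}.
Implicit Types (p s : R) (x y t : 'rV[R]_d).

Definition lpnorm p x : R := (\sum_(i < d) `|x ord0 i| `^ p) `^ p^-1.

Definition lpball p : set 'rV[R]_d := [set x | lpnorm p x <= 1].

Definition is_projection (K : set 'rV[R]_d) y x :=
  K x /\ forall z, K z -> lpnorm 2 (y - x) <= lpnorm 2 (y - z).

(* [0] is only a default value: the projection exists and is unique when [K]
   is nonempty, closed and convex, as is [lpball p] for [1 <= p]. *)
Definition projection (K : set 'rV[R]_d) y : 'rV[R]_d :=
  xget 0 [set x | is_projection K y x].

(* The law N(t, s^2 I_d), for [s != 0].  It is carried by d-tuples, which have
   the product sigma-algebra; [row_of_tuple] identifies them with vectors. *)
Definition gaussian t s : probability (d.-tuple (measurableTypeR R)) R :=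
  prod_probability (fun i : 'I_d => normal_prob (t ord0 i) s).

Definition row_of_tuple (w : d.-tuple R) : 'rV[R]_d := \row_i tnth w i.

Definition mle_risk p s t : \bar R :=
  ('E_(gaussian t s)[fun w =>
     (lpnorm 2 (projection (lpball p) (row_of_tuple w) - t) ^+ 2)%R])%E.

Definition e1 : 'rV[R]_d := \row_(i < d) ((i : nat) == 0%N)%:R.

End lp_ball.

(* Main.v *)
Require Import Defs.
From mathcomp Require Import ring lra measurable_realfun.

(* Let Y = e1 + s * xi, x = projection Y and u = Y - e1, and suppose that x lies
   within 1/32 of e1.  The variational inequality of the projection then reads
   <u, z - x> <= 1/16 for every z in the ball.  Since x has p-mass close to 1 on
   the first coordinate, its remaining part x' satisfies |x'|_p <= 1/4, and
   z = (0, 4 x') shows that <u, x> is at most a constant plus 4/3 |u_0|.  On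
   the other hand, for S a set of m coordinates where |u_j| >= s sqrt q, the
   vector z with entries sgn(u_j) m^(-1/p) on S has <u, z> >= s sqrt q m^(1/q).
   With probability bounded below, |xi_0| <= 1/100 and m >= d e^(-q) / 96; then
   s sqrt q m^(1/q) >= s sqrt q d^(1/q) / 40, which contradicts the previous
   bounds when s sqrt q d^(1/q) >= 10. *)

Local Open Scope classical_set_scope.
Local Open Scope ring_scope.

Import HBNNSimple.

(** * Lower bounds for integrals, and finite unions *)

(** Both integrals are suprema over simple functions lying below the integrand, and any such
    function below [c * \1_E] lies below [f]. Measurability of [f] never enters, so the bound
    applies to the squared error of the projection directly. *)
Lemma ge0_integral_ge {d} {T : measurableType d} {R : realType}
    (mu : {measure set T -> \bar R}) (f : T -> \bar R) (E : set T) (c : R) :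
  measurable E -> 0 <= c -> (forall x, (0 <= f x)%E) ->
  (forall x, E x -> (c%:E <= f x)%E) -> (c%:E * mu E <= \int[mu]_x f x)%E.
Proof.
move=> mE c0 f0 cf.
have -> : (c%:E * mu E = \int[mu]_x (c * \1_E x)%:E)%E.
  under eq_integral do rewrite EFinM.
  rewrite ge0_integralZl ?lee_fin//; last exact/measurable_EFinP/measurable_indic.
  by rewrite integral_indic// setIT.
rewrite !ge0_integralTE//; last by move=> x; rewrite lee_fin mulr_ge0.
apply: ereal_sup_le => _ /= [h hf <-].
exists h => // x; apply: (le_trans (hf x)).
rewrite indicE; have [xE|xE] := boolP (x \in E); last by rewrite mulr0.
by rewrite mulr1; apply: cf; rewrite inE in xE.
Qed.

Lemma measure_bigcup_fin_le {d} {T : measurableType d} {R : realType}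
    (mu : {measure set T -> \bar R}) (I : finType) (P : pred I)
    (F : I -> set T) : (forall i, measurable (F i)) ->
  (mu (\big[setU/set0]_(i | P i) F i) <= \sum_(i | P i) mu (F i))%E.
Proof.
move=> mF.
suff [] : measurable (\big[setU/set0]_(i | P i) F i) /\
  (mu (\big[setU/set0]_(i | P i) F i) <= \sum_(i | P i) mu (F i))%E by [].
elim/big_rec2: _ => [|i x y Pi [mx le_xy]]; first by rewrite measure0.
split; first exact: measurableU.
by apply: le_trans (measureU2 _ _ _) _ => //; rewrite leeD2l.
Qed.

(** * Gaussian intervals and counts of independent hits *)

(** On the interval the density is at least its value at distance [s * g] from the mean. The length
    [s * (b - a)] cancels the factor [s^-1] of the peak, so the bound does not depend on [s]. *)
Lemma normal_prob_itv_ge {R : realType} (m s a b g : R) :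
  0 < s -> a <= b -> `|a| <= g -> `|b| <= g ->
  (((b - a) * (Num.sqrt (pi *+ 2))^-1 * expR (- (g ^+ 2 / 2)))%:E <=
   normal_prob m s `[(m + s * a)%R, (m + s * b)%R])%E.
Proof.
move=> s0 ab ag bg.
have sb : m + s * a <= m + s * b by rewrite lerD2l ler_pM2l.
have g0 : 0 <= g by apply: le_trans ag.
pose k := normal_peak s * expR (- (g ^+ 2 / 2)).
have k0 : 0 <= k by rewrite mulr_ge0 ?normal_peak_ge0 ?expR_ge0.
have -> : ((b - a) * (Num.sqrt (pi *+ 2))^-1 * expR (- (g ^+ 2 / 2)))%:E
  = (\int[lebesgue_measure]_(x in `[(m + s * a)%R, (m + s * b)%R]) k%:E)%E.
  rewrite integral_cst//= lebesgue_measure_itv/=.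
  have [e|ne] := eqVneq a b.
    by rewrite e ltxx mule0 subrr !mul0r.
  rewrite lte_fin ltrD2l ltr_pM2l// lt_neqAle ne ab/= -EFinB -EFinM /k.
  have -> : normal_peak s = s^-1 * (Num.sqrt (pi *+ 2))^-1.
    by rewrite /normal_peak -mulrnAr sqrtrM ?sqr_ge0// sqrtr_sqr gtr0_norm// invfM.
  have s'0 : s != 0 by rewrite gt_eqF.
  set r := (Num.sqrt _)^-1; set e := expR _; apply/congr1; clearbody r e; by field.
rewrite /normal_prob; apply: ge0_le_integral => //.
- by apply/measurable_EFinP/measurable_funTS; exact: measurable_normal_pdf.
- move=> x /=; rewrite in_itv/= => /andP[ax xb].
  rewrite lee_fin normal_pdfE ?gt_eqF// ler_wpM2l ?normal_peak_ge0// ler_expR.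
  have -> : - (x - m) ^+ 2 / (s ^+ 2 *+ 2) = - (((x - m) / s) ^+ 2 / 2).
    by rewrite -mulr_natr; field; rewrite gt_eqF.
  rewrite lerN2 ler_pM2r ?invr_gt0// -[leLHS]real_normK ?num_real//.
  rewrite lerXn2r ?nnegrE//.
  have xa : a <= (x - m) / s by rewrite ler_pdivlMr// mulrC lerBrDl.
  have xb' : (x - m) / s <= b by rewrite ler_pdivrMr// mulrC lerBlDl.
  rewrite ler_norml; move: ag bg; rewrite !ler_norml => /andP[ag _] /andP[_ bg].
  by rewrite (le_trans ag xa) (le_trans xb' bg).
Qed.

(* Chernoff: bound the indicator of [#|S| < t] by [expR (t - #|S|)]. *)
Lemma binomial_lower_tail {R : realType} n (p t : R) : 0 <= p <= 1 ->
  \sum_(S : {set 'I_n} | ~~ (t <= #|S|%:R))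
    \prod_(j < n) (if j \in S then p else 1 - p) <= expR (t - n%:R * (p / 2)).
Proof.
move=> /andP[p0 p1].
have e2 : expR (-1) <= 2^-1 :> R.
  rewrite expRN lef_pV2 ?posrE ?expR_gt0//.
  by have := expR_ge1Dx (1 : R); rewrite -[1 + 1]/(2%:R).
have e0 := expR_ge0 (-1 : R).
have w0 S : 0 <= \prod_(j < n) (if j \in S then p else 1 - p).
  by apply: prodr_ge0 => j _; case: ifP => _; rewrite ?subr_ge0.
apply: (@le_trans _ _ (\sum_(S : {set 'I_n})
    expR (t - #|S|%:R) * \prod_(j < n) (if j \in S then p else 1 - p))).
  rewrite big_mkcond; apply: ler_sum => S _; case: ifPn => [|_]; last first.
    by rewrite mulr_ge0 ?expR_ge0.
  rewrite -ltNge => St; rewrite ler_peMl//.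
  by rewrite -[leLHS]expR0 ler_expR subr_ge0 ltW.
(* Expanding the product over coordinates: [j] in [S] contributes [expR (-1) * p], and [j] outside
   [S] contributes [1 - p]. *)
have -> : \sum_(S : {set 'I_n})
    expR (t - #|S|%:R) * \prod_(j < n) (if j \in S then p else 1 - p) =
  expR t * \prod_(j < n) (expR (-1) * p + (1 - p)).
  rewrite bigA_distr big_distrr/=; apply: eq_bigr => S _.
  rewrite expRD -mulrA; congr (_ * _).
  rewrite (bigID (mem S))/= [in RHS](bigID (mem S))/= mulrA; congr (_ * _).
    under eq_bigr => j -> do [].
    under [in RHS]eq_bigr => j -> do [].
    by rewrite !prodr_const exprMn -expRM_natl mulrN mulr1.
  by apply: eq_bigr => j /negbTE ->.
(* Since [expR (-1) <= 1/2], each factor is at most [1 - p / 2 <= expR (- (p / 2))]. *)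
rewrite expRD ler_wpM2l ?expR_ge0// prodr_const card_ord -mulrN expRM_natl.
rewrite lerXn2r ?nnegrE ?expR_ge0//; first by nra.
by apply: le_trans (expR_ge1Dx _); nra.
Qed.

(* The bad event is covered by the rectangles fixing which coordinates fall in
   [G], so only the values of the product probability on rectangles matter. *)
Lemma prod_probability_card_ge {R : realType} {d} {T : measurableType d} n
    (P : 'I_n.+1 -> probability T R) (A G : set T) (p t : R) :
  measurable A -> measurable G -> 0 <= p <= 1 -> (forall i, P (lift ord0 i) G = p%:E) ->
  exists E : set (n.+1.-tuple T), [/\ measurable E,
    (P ord0 A * (1 - expR (t - n%:R * (p / 2)))%:E <= prod_probability P E)%E &
    forall w, E w -> A (tnth w ord0) /\
      t <= #|[set j : 'I_n | tnth w (lift ord0 j) \in G]%SET|%:R].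
Proof.
move=> mA mG p01 PG.
have PGC i : P (lift ord0 i) (~` G) = (1 - p)%:E.
  by rewrite probability_setC// PG.
pose B (S : {set 'I_n}) (i : 'I_n.+1) : set T :=
  if unlift ord0 i is Some j then if j \in S then G else ~` G else A.
have mB S i : measurable (B S i).
  rewrite /B; case: unliftP => [j|] _ //; case: ifP => // _; exact: measurableC.
pose rect (S : {set 'I_n}) := [set w : n.+1.-tuple T | forall i, B S i (tnth w i)].
have mcyl m (C : 'I_m -> set T) : (forall i, measurable (C i)) ->
    measurable [set w : m.-tuple T | forall i, C i (tnth w i)].
  move=> mC; rewrite [X in measurable X](_ : _ =
      \bigcap_(i in [set: 'I_m]) ((@tnth m T ^~ i) @^-1` C i)); last first.
    by apply/seteqP; split => x /= Cx i; [move=> _; exact: Cx | exact: Cx].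
  apply: fin_bigcap_measurable => // i _.
  by rewrite -[X in measurable X]setTI; exact: measurable_tnth.
have mrect S : measurable (rect S) by exact: mcyl.
have Prect S : prod_probability P (rect S) =
    (P ord0 A * (\prod_(j < n) (if j \in S then p else 1 - p))%:E)%E.
  rewrite prod_probabilityE// big_ord_recl /B unlift_none; congr (_ * _)%E.
  rewrite -prodEFin; apply: eq_bigr => j _.
  by rewrite liftK; case: ifP.
pose bad := \big[setU/set0]_(S : {set 'I_n} | ~~ (t <= #|S|%:R)) rect S.
have mbad : measurable bad by apply: bigsetU_measurable.
pose C (i : 'I_n.+1) : set T := if i == ord0 then A else setT.
pose cyl := [set w : n.+1.-tuple T | forall i, C i (tnth w i)].
have mCyl : measurable cyl by apply: mcyl => i; rewrite /C; case: ifP.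
have Pcyl : prod_probability P cyl = P ord0 A.
  rewrite prod_probabilityE; last by move=> i; rewrite /C; case: ifP.
  rewrite big_ord_recl /C eqxx big1 ?mule1// => i _.
  exact: probability_setT.
(* Every rectangle in [bad] carries the factor [P ord0 A], so removing [bad] costs at most
   [P ord0 A] times the binomial tail. *)
exists (cyl `\` bad); split.
- exact: measurableD.
- have Pbad : (prod_probability P bad <=
      P ord0 A * (expR (t - n%:R * (p / 2)))%:E)%E.
    apply: le_trans (measure_bigcup_fin_le _ _ _ _ mrect) _.
    rewrite (eq_bigr _ (fun S _ => Prect S)).
    rewrite -ge0_sume_distrr; last first.
      move=> S _; rewrite lee_fin prodr_ge0// => j _.
      by case/andP: p01 => p0 p1; case: ifP => _ //; rewrite subr_ge0.
    by rewrite sumEFin lee_wpmul2l// lee_fin binomial_lower_tail.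
  rewrite EFinB muleBr// ?fin_num_measure//.
  rewrite mule1 leeBlDr ?fin_numM ?fin_num_measure//.
  rewrite -Pcyl; apply: (@le_trans _ _ (prod_probability P (cyl `\` bad `|` bad))).
    apply: le_measure; rewrite ?inE//.
      by apply: measurableU => //; exact: measurableD.
    by move=> w cw; have [bw|bw] := pselect (bad w); [right|left].
  apply: le_trans (measureU2 _ _ _) _ => //; first exact: measurableD.
  by rewrite Pcyl; exact: leeD2l.
- move=> w [cw bw]; split; first by have := cw ord0; rewrite /C eqxx.
  set S := [set j | _]%SET.
  (* A point of [cyl] with too few hits lies in the rectangle of its own hit set [S], hence in
     [bad]. *)
  apply: contra_notT bw => St; rewrite /bad -bigcup_seq_cond.
  exists S => /=; first by rewrite mem_index_enum.
  move=> i; rewrite /B; case: unliftP => [j ->|->].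
    by rewrite inE; case: ifPn => [|/negP]; rewrite inE.
  by have := cw ord0; rewrite /C eqxx.
Qed.

(** * Geometry of the ball and of the Euclidean projection *)

Lemma lpballE {R : realType} d (p : R) (x : 'rV[R]_d) : 0 < p ->
  lpball p x <-> \sum_i `|x ord0 i| `^ p <= 1.
Proof.
move=> p0; rewrite /lpball /lpnorm /=; set s := \sum_i _.
have s0 : 0 <= s by apply: sumr_ge0 => i _; exact: powR_ge0.
have -> : (s `^ p^-1 <= 1) = (s <= 1); last by [].
have one : 1 `^ p^-1 = 1 :> R by rewrite powR1.
have [s1|s1] := leP s 1.
  rewrite -[leRHS]one ge0_ler_powR ?nnegrE ?invr_ge0//; exact: ltW.
apply/negbTE; rewrite -ltNge -[ltLHS]one gt0_ltr_powR ?invr_gt0 ?nnegrE//.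
Qed.

Lemma sqr_lpnorm2 {R : realType} d (x : 'rV[R]_d) :
  lpnorm 2 x ^+ 2 = \sum_i (x ord0 i) ^+ 2.
Proof.
rewrite /lpnorm -powR_mulrn ?powR_ge0// -powRrM mulVf ?pnatr_eq0// powRr1.
  apply: eq_bigr => i _; by rewrite powR_mulrn// real_normK ?num_real.
by apply: sumr_ge0 => i _; exact: powR_ge0.
Qed.

Lemma ler_lpnorm2 {R : realType} d (x y : 'rV[R]_d) : lpnorm 2 x <= lpnorm 2 y ->
  \sum_i (x ord0 i) ^+ 2 <= \sum_i (y ord0 i) ^+ 2.
Proof. by move=> xy; rewrite -!sqr_lpnorm2 lerXn2r ?nnegrE ?powR_ge0. Qed.

Lemma lpball_convex {R : realType} d (p t : R) (x z : 'rV[R]_d) :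
  1 <= p -> 0 <= t <= 1 -> lpball p x -> lpball p z ->
  lpball p (x + t *: (z - x)).
Proof.
move=> p1 /andP[t0 t1]; have p0 : 0 < p by apply: lt_le_trans p1.
rewrite !lpballE// => xp zp.
apply: (@le_trans _ _ (\sum_i (t * `|z ord0 i| `^ p + (1 - t) * `|x ord0 i| `^ p))).
  apply: ler_sum => i _; rewrite !mxE.
  apply: (@le_trans _ _ ((t * `|z ord0 i| + (1 - t) * `|x ord0 i|) `^ p)).
    rewrite ge0_ler_powR ?nnegrE ?addr_ge0 ?mulr_ge0 ?subr_ge0 ?(ltW p0)//.
    have -> : x ord0 i + t * (z ord0 i - x ord0 i) =
       t * z ord0 i + (1 - t) * x ord0 i by ring.
    by rewrite (le_trans (ler_normD _ _))// !normrM (ger0_norm t0) (@ger0_norm _ (1 - t)) ?subr_ge0.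
  by apply: (convex_powR p1 (Itv01 t0 t1)); rewrite ?inE/= ?in_itv/= ?normr_ge0.
rewrite big_split/= -!mulr_sumr; nra.
Qed.

(** Each coordinate has modulus at most 1, so its square is at most its [p]-th power. *)
Lemma lpball_sum_sqr_le1 {R : realType} d (p : R) (x : 'rV[R]_d) :
  0 < p <= 2 -> lpball p x -> \sum_i (x ord0 i) ^+ 2 <= 1.
Proof.
move=> /andP[p0 p2]; rewrite lpballE// => xp; apply: le_trans (xp).
apply: ler_sum => i _; rewrite -[leLHS]real_normK ?num_real//.
have [->|xi0] := eqVneq (x ord0 i) 0; first by rewrite normr0 expr0n powR_ge0.
rewrite -powR_mulrn// ger_powR// normr_gt0 xi0/=.
have : `|x ord0 i| `^ p <= 1.
  by apply: le_trans xp; rewrite (bigD1 i)//= lerDl sumr_ge0// => j _; exact: powR_ge0.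
apply: contraTT; rewrite -!ltNge => x1.
have one : 1 `^ p = 1 :> R by rewrite powR1.
by rewrite -[ltLHS]one gt0_ltr_powR ?nnegrE.
Qed.

Lemma lpball_projectionP {R : realType} d (p : R) (x y z : 'rV[R]_d) : 1 <= p ->
  is_projection (lpball p) y x -> lpball p z ->
  \sum_i (y - x) ord0 i * (z - x) ord0 i <= 0.
Proof.
move=> p1 [xp xmin] zp.
set A := \sum_i _; pose B := \sum_i ((z - x) ord0 i) ^+ 2.
have B0 : 0 <= B by apply: sumr_ge0 => i _; exact: sqr_ge0.
have AB t : 0 <= t <= 1 -> 2 * t * A <= t ^+ 2 * B.
  move=> t01; have := ler_lpnorm2 _ _ _ (xmin _ (lpball_convex d p t x z p1 t01 xp zp)).
  have -> : \sum_i (y - (x + t *: (z - x))) ord0 i ^+ 2 =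
      \sum_i (y - x) ord0 i ^+ 2 - 2 * t * A + t ^+ 2 * B.
    rewrite /A /B !mulr_sumr -sumrB -big_split/=.
    by apply: eq_bigr => i _; rewrite !mxE; ring.
  by rewrite -addrA lerDl; lra.
rewrite leNgt; apply/negP => A0.
have AB0 : 0 < A + B by exact: ltr_wpDr.
(* This [t] lies in (0, 1] even if [B = 0]. It satisfies [t * B = A - t * A < A], while [AB] divided
   by [t] gives [2 * A <= t * B]. *)
have t0 : 0 < A / (A + B) by rewrite divr_gt0.
have t1 : A / (A + B) <= 1 by rewrite ler_pdivrMr ?mul1r ?lerDl.
have tAB : A / (A + B) * (A + B) = A by rewrite divfK ?gt_eqF.
have := AB _ (introT andP (conj (ltW t0) t1)).
move: (A / (A + B)) t0 tAB => t t0 tAB.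
rewrite [_ * t]mulrC -mulrA expr2 -[leRHS]mulrA ler_pM2l// => le_tB.
have : 0 < t * A by rewrite mulr_gt0.
lra.
Qed.

Lemma projection_near_e1 {R : realType} n (p q h : R) (x y : 'rV[R]_n.+1)
    (S : {set 'I_n}) :
  1 < p <= 2 -> q^-1 = 1 - p^-1 -> 0 <= h -> (0 < #|S|)%N ->
  (forall j, j \in S -> h <= `|y ord0 (lift ord0 j)|) ->
  is_projection (lpball p) y x -> lpnorm 2 (x - e1) <= 32^-1 ->
  h * #|S|%:R `^ q^-1 <= 12^-1 + 4 / 3 * `|y ord0 ord0 - 1|.
Proof.
move=> /andP[p1 p2] qp h0 S0 hS proj near.
have p0 : 0 < p by apply: lt_trans p1.
have xp := proj.1.
pose u := y - e1 : 'rV[R]_n.+1.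
have u_lift j : u ord0 (lift ord0 j) = y ord0 (lift ord0 j).
  by rewrite !mxE/= subr0.
have x2 := lpball_sum_sqr_le1 _ p x (introT andP (conj p0 p2)) xp.
have near2 : \sum_i ((x - e1) ord0 i) ^+ 2 <= 1024^-1.
  rewrite -(sqr_lpnorm2 _ (x - e1)).
  have -> : 1024^-1 = 32^-1 ^+ 2 :> R by field.
  by rewrite lerXn2r ?nnegrE ?powR_ge0.
have key z : lpball p z -> \sum_i u ord0 i * (z ord0 i - x ord0 i) <= 16^-1.
  move=> zp; have z2 := lpball_sum_sqr_le1 _ p z (introT andP (conj p0 p2)) zp.
  have := lpball_projectionP _ p x y z (ltW p1) proj zp.
  suff : \sum_i u ord0 i * (z ord0 i - x ord0 i) -
    \sum_i (y - x) ord0 i * (z - x) ord0 i <= 16^-1 by lra.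
  (* The difference is the inner product of [x - e1] and [z - x]. The weights 32 and 1/64 bound it
     by 32/1024 + 2/64 = 1/16. *)
  rewrite -sumrB.
  apply: (@le_trans _ _ (\sum_i (32 * ((x - e1) ord0 i) ^+ 2 +
     64^-1 * (z ord0 i ^+ 2 + x ord0 i ^+ 2)))).
    apply: ler_sum => i _; rewrite /u !mxE.
    set e := (_%:R : R); move: (y _ _) (x _ _) (z _ _) => b a c.
    (* AM-GM on [(a - e) * (c - a)], and [(c - a)^2 <= 2 (c^2 + a^2)] *)
    have := sqr_ge0 (64 * (a - e) - (c - a)); have := sqr_ge0 (c + a).
    nra.
  rewrite big_split/= -!mulr_sumr big_split/=; lra.
pose v (a : R) (f : 'I_n -> R) : 'rV[R]_n.+1 :=
  \row_i oapp f a (unlift ord0 i).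
have key0 f : \sum_j `|f j| `^ p <= 1 ->
    \sum_j u ord0 (lift ord0 j) * (f j - x ord0 (lift ord0 j)) <=
    16^-1 + u ord0 ord0 * x ord0 ord0.
  move=> fp; have /key : lpball p (v 0 f).
    apply/lpballE => //; rewrite big_ord_recl !mxE unlift_none/= normr0 powR0 ?gt_eqF//.
    by rewrite add0r; under eq_bigr do rewrite mxE liftK/=.
  rewrite big_ord_recl [v 0 f _ _]mxE unlift_none/=.
  under eq_bigr do rewrite [v 0 f _ _]mxE liftK/=.
  lra.
have x0le1 : `|x ord0 ord0| <= 1.
  rewrite -(@expr_le1 _ 2)// real_normK ?num_real// (le_trans _ x2)//.
  by rewrite big_ord_recl lerDl sumr_ge0// => j _; exact: sqr_ge0.
have x0ge : 31 / 32 <= x ord0 ord0.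
  have : (x ord0 ord0 - 1) ^+ 2 <= 1024^-1.
    apply: le_trans near2; rewrite big_ord_recl !mxE/= lerDl.
    by apply: sumr_ge0 => j _; exact: sqr_ge0.
  nra.
pose W := \sum_j u ord0 (lift ord0 j) * x ord0 (lift ord0 j).
have W_le : 3 * W <= 16^-1 + u ord0 ord0 * x ord0 ord0.
  (* Taking [f] to be four times the tail of [x] gives the factor 3 = 4 - 1. It is admissible
     because 4^p <= 16 and the tail has [p]-mass at most 1 - x_0^2 <= 1 - (31/32)^2 = 63/1024 <
     1/16. *)
  suff /key0 : \sum_j `|4 * x ord0 (lift ord0 j)| `^ p <= 1.
    under eq_bigr => j _.
      rewrite (_ : _ * _ = 3 * (u ord0 (lift ord0 j) * x ord0 (lift ord0 j))); last by ring.
      over.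
    by rewrite -mulr_sumr.
  apply: (@le_trans _ _ (16 * \sum_j `|x ord0 (lift ord0 j)| `^ p)).
    rewrite mulr_sumr; apply: ler_sum => j _; rewrite normrM powRM//.
    rewrite ler_wpM2r ?powR_ge0// ger0_norm//.
    apply: (@le_trans _ _ (4 `^ 2)); first by rewrite ler_powR// ler1n.
    by rewrite powR_mulrn// -natrX.
  have := (lpballE _ p x p0).1 xp; rewrite big_ord_recl.
  have : `|x ord0 ord0| ^+ 2 <= `|x ord0 ord0| `^ p.
    by rewrite -powR_mulrn// ger_powR// x0le1 normr_gt0 gt_eqF//; lra.
  rewrite real_normK ?num_real//; nra.
have -> : y ord0 ord0 - 1 = u ord0 ord0 by rewrite !mxE.
have ux : u ord0 ord0 * x ord0 ord0 <= `|u ord0 ord0|.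
  by rewrite (le_trans (ler_norm _))// normrM ler_piMr.
pose m : R := #|S|%:R.
have m0 : 0 < m by rewrite ltr0n.
pose f j := if j \in S then Num.sg (u ord0 (lift ord0 j)) * m `^ (- p^-1) else 0.
have /key0 : \sum_j `|f j| `^ p <= 1.
  apply: (@le_trans _ _ (\sum_(j in S) m^-1)).
    rewrite [leRHS]big_mkcond/=; apply: ler_sum => j _; rewrite /f.
    case: ifP => _; last by rewrite normr0 powR0// gt_eqF.
    rewrite normrM (ger0_norm (powR_ge0 _ _)) powRM ?powR_ge0//.
    rewrite -powRrM mulNr mulVf ?gt_eqF// powR_inv1 ?(ltW m0)// ler_piMl ?invr_ge0 ?(ltW m0)//.
    rewrite normr_sg; case: eqP => _ /=; first by rewrite powR0// gt_eqF.
    by rewrite powR1.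
  by rewrite sumr_const -mulr_natl mulfV ?gt_eqF.
under eq_bigr do rewrite mulrBr.
rewrite sumrB -/W.
(* [key0] bounds the sum by [1/16 + |u_0| + W], and [W_le] bounds [W] by a third of [1/16 + |u_0|];
   the total is [1/12 + 4/3 |u_0|]. *)
suff : h * m `^ q^-1 <= \sum_j u ord0 (lift ord0 j) * f j by lra.
have -> : h * m `^ q^-1 = \sum_(j in S) h * m `^ (- p^-1).
  have -> : m `^ q^-1 = m * m `^ (- p^-1).
    rewrite qp powRD; first by rewrite powRr1// ltW.
    by rewrite (gt_eqF m0) implybT.
  by rewrite sumr_const -mulr_natl -/m mulrCA.
rewrite big_mkcond/=; apply: ler_sum => j _; rewrite /f.
case: ifP => [/hS hj|_]; last by rewrite mulr0.
rewrite mulrA ler_wpM2r ?powR_ge0// u_lift.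
by rewrite mulrC -normrEsg.
Qed.

(** * Numerical estimates *)

(** Here [L] stands for [ln d]. As [q = 1 + 1 / (p - 1)], the lower bound on [p] becomes
    [q <= 2 + L], which keeps [d * expR (- q)] above [expR (-2)]. *)
Lemma dual_exponent_bounds {R : realType} (p q L : R) : 0 <= L ->
  1 + (1 + L)^-1 <= p <= 2 -> q = p / (p - 1) ->
  [/\ 1 < p, 2 <= q, q <= 2 + L & q^-1 = 1 - p^-1].
Proof.
move=> L0 /andP[p1 p2] ->.
have L1 : 0 < (1 + L)^-1 by rewrite invr_gt0 ltr_pwDl.
have pm1 : 0 < p - 1 by lra.
split; first lra.
- by rewrite ler_pdivlMr//; lra.
- rewrite ler_pdivrMr//.
  have : (1 + L) * (1 + L)^-1 = 1 by rewrite mulfV// gt_eqF// ltr_pwDl.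
  nra.
- by field; rewrite !gt_eqF//; lra.
Qed.

Lemma inv_sqrt_2pi_ge {R : realType} : 3^-1 <= (Num.sqrt (pi *+ 2 : R))^-1.
Proof.
have [p0 p2] := andP (@pihalf_02 R).
have s0 : 0 < Num.sqrt (pi *+ 2 : R) by rewrite sqrtr_gt0 -mulr_natr; lra.
rewrite lef_pV2 ?posrE// -[leRHS]ger0_norm// -sqrtr_sqr.
by apply: ler_wsqrtr; rewrite -mulr_natr; lra.
Qed.

(** Square of [expR (- 1/2) >= 1 - 1/2]. *)
Lemma expRN1_ge {R : realType} : 4^-1 <= expR (-1 : R).
Proof.
have -> : -1 = 2%:R * (- 2^-1) :> R by field.
rewrite expRM_natl.
have := expR_ge1Dx (- 2^-1 : R).
nra.
Qed.

Lemma measurable_le_normr {R : realType} (a : R) :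
  measurable [set x : R | a <= `|x|].
Proof.
rewrite [X in measurable X](_ : _ = setT `&` Num.norm @^-1` `[a, +oo[%classic).
  exact: normr_measurable.
by rewrite setTI; apply/seteqP; split => x /=; rewrite in_itv/= andbT.
Qed.

(** Only the interval from [s * r] to [s * (r + 1)] is kept. There (r + 1)^2 / 2 <= 1 + r^2, and
    1/12 is the product of [expR (-1) >= 1/4] and the peak bound 1/3. *)
Lemma normal_prob_tail_ge {R : realType} (s r : R) : 0 < s -> 0 <= r ->
  ((12^-1 * expR (- r ^+ 2))%:E <=
   normal_prob 0 s [set x | (s * r <= `|x|)%R])%E.
Proof.
move=> s0 r0.
apply: (@le_trans _ _ (normal_prob 0 s `[(0 + s * r)%R, (0 + s * (r + 1))%R])).
  have := normal_prob_itv_ge 0 s r (r + 1) (r + 1) s0.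
  rewrite lerDl ler01 !ger0_norm ?addr_ge0// => /(_ isT) h.
  apply: le_trans (h _ _) => //; last by rewrite lerDl.
  rewrite lee_fin addrC addKr mul1r.
  apply: (@le_trans _ _ (3^-1 * expR (-1 - r ^+ 2))).
    have := @expRN1_ge R; rewrite expRD; have := expR_ge0 (- r ^+ 2); nra.
  apply: ler_pM; rewrite ?expR_ge0 ?inv_sqrt_2pi_ge// ler_expR.
  have := sqr_ge0 (r - 1); nra.
apply: le_measure; rewrite ?inE//.
  exact: measurable_le_normr.
move=> x /=; rewrite in_itv/= !add0r => /andP[sx _].
by rewrite (le_trans sx)// ler_norm.
Qed.

(** The root of [expR (- q)] is [expR (-1) >= 1/4], and since [q >= 2] the root of 1/96 is at least
    100^(-1/2) = 1/10. *)
Lemma powR_card_ge {R : realType} (D m q : R) : 0 <= D -> 2 <= q ->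
  D * expR (- q) / 96 <= m -> D `^ q^-1 / 40 <= m `^ q^-1.
Proof.
move=> D0 q2 Dm.
have q0 : 0 < q by lra.
apply: (@le_trans _ _ ((D * expR (- q) / 96) `^ q^-1)); last first.
  rewrite ge0_ler_powR ?nnegrE ?invr_ge0 ?(ltW q0)//.
    by rewrite !mulr_ge0 ?expR_ge0.
  by apply: le_trans Dm; rewrite !mulr_ge0 ?expR_ge0.
rewrite !powRM ?mulr_ge0 ?expR_ge0// -expRM mulNr mulfV ?gt_eqF//.
rewrite -mulrA ler_wpM2l ?powR_ge0//.
have h : 10^-1 <= (96^-1 : R) `^ q^-1.
  apply: (@le_trans _ _ ((100^-1 : R) `^ q^-1)).
    apply: (@le_trans _ _ ((100^-1 : R) `^ 2^-1)).
      have -> : 100^-1 = 10^-1 ^+ 2 :> R by field.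
      by rewrite powR12_sqrt ?sqr_ge0// sqrtr_sqr ger0_norm.
    by rewrite ger_powR ?lef_pV2 ?posrE//; lra.
  by rewrite ge0_ler_powR ?nnegrE ?invr_ge0 ?(ltW q0)//; lra.
have := @expRN1_ge R; nra.
Qed.

(** * The pointwise error bound and the choice of constants *)

Lemma lpball_e1 {R : realType} n (p : R) : 0 < p -> lpball p (e1 : 'rV[R]_n.+1).
Proof.
move=> p0; apply/lpballE => //; rewrite big_ord_recl big1 ?addr0 => [|j _].
  by rewrite mxE normr1 powR1.
by rewrite mxE normr0 powR0// gt_eqF.
Qed.

(** The deterministic half: the last two hypotheses describe the event whose probability is bounded
    below afterwards. *)
Lemma projection_error_ge {R : realType} n (p q s : R) (w : n.+1.-tuple R) :
  1 < p <= 2 -> 2 <= q -> q^-1 = 1 - p^-1 -> 0 < s ->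
  10 <= s * (Num.sqrt q * n.+1%:R `^ q^-1) ->
  `|tnth w ord0 - 1| <= s / 100 ->
  n.+1%:R * expR (- q) / 96 <=
    #|[set j : 'I_n | (s * Num.sqrt q <= `|tnth w (lift ord0 j)|)%R]%SET|%:R ->
  1024^-1 <= lpnorm 2 (projection (lpball p) (row_of_tuple w) - e1) ^+ 2.
Proof.
move=> p12 q2 qp s0 X10 w0; set S := [set j | _]%SET => Sge.
(* If there were no projection, its default value 0 would be at distance 1. *)
rewrite /projection; case: xgetP => [x _ proj|_].
  have -> : 1024^-1 = 32^-1 ^+ 2 :> R by field.
  rewrite ler_pXn2r ?nnegrE ?powR_ge0// leNgt; apply/negP => /ltW near.
  have S0 : (0 < #|S|)%N.
    rewrite -(ltr0n R); apply: lt_le_trans Sge.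
    by rewrite !mulr_gt0 ?expR_gt0.
  have h0 : 0 <= s * Num.sqrt q by rewrite mulr_ge0 ?sqrtr_ge0 ?ltW.
  have hS j : j \in S -> s * Num.sqrt q <= `|row_of_tuple w ord0 (lift ord0 j)|.
    by rewrite inE mxE.
  have := projection_near_e1 n p q _ x (row_of_tuple w) S p12 qp h0 S0 hS proj near.
  rewrite mxE => le1.
  have := powR_card_ge n.+1%:R _ q (ler0n _ _) q2 Sge.
  have : 1 <= (n.+1%:R : R) `^ q^-1.
    by rewrite -[leLHS](powRr0 n.+1%:R) ler_powR ?ler1n// invr_ge0; lra.
  move: (_ `^ q^-1) (#|S|%:R `^ q^-1) X10 le1 => D M X10 le1 D1 DM.
  have q1 : 1 <= Num.sqrt q.
    by rewrite -[leLHS]sqrtr1 ler_wsqrtr//; lra.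
  (* With [X = s * (Num.sqrt q * D)], these give [X / 40 <= 1/12 + 4/3 * (s / 100) <= 1/12 + X /
     75]. But [X >= 10] makes [X * (1/40 - 1/75)] at least 7/60 > 1/12. *)
  have : s * Num.sqrt q * (D / 40) <= s * Num.sqrt q * M by rewrite ler_wpM2l.
  have : s <= s * (Num.sqrt q * D) by rewrite ler_peMr ?(ltW s0)// mulr_ege1.
  lra.
rewrite sqr_lpnorm2 big_ord_recl.
have -> : (0 - e1 : 'rV[R]_n.+1) ord0 ord0 = -1 by rewrite !mxE/= sub0r.
apply: (@le_trans _ _ ((-1) ^+ 2)); first by rewrite sqrrN expr1n; lra.
by rewrite lerDl sumr_ge0// => j _; exact: sqr_ge0.
Qed.

Theorem proposition1 (R : realType) :
  exists2 c : R, 0 < c &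
    forall (d : nat) (p q sigma : R),
      (45 <= d)%N ->
      1 + (1 + ln d%:R)^-1 <= p <= 2 ->
      q = p / (p - 1) ->
      10 / (Num.sqrt q * d%:R `^ q^-1) <= sigma ->
      (c%:E <= ereal_sup [set mle_risk p sigma t | t in @lpball R d p])%E /\
      (c%:E <= mle_risk p sigma (@e1 R d))%E.
Proof.
(* [a] bounds from below the probability that the first coordinate is within [s / 100] of 1, and [b]
   the probability of enough large coordinates among the others. *)
have [a aE a0] : exists2 a : R, a = (100^-1 - - 100^-1) *
    (Num.sqrt (pi *+ 2))^-1 * expR (- (100^-1 ^+ 2 / 2)) & 0 < a.
  eexists; first reflexivity.
  have h0 : 0 < 100^-1 - - 100^-1 :> R by lra.
  have k0 : 0 < (Num.sqrt (pi *+ 2 : R))^-1 by have := @inv_sqrt_2pi_ge R; lra.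
  exact: mulr_gt0 (mulr_gt0 h0 k0) (expR_gt0 _).
have [b bE b0] : exists2 b : R, b = 1 - expR (- (expR (- 2) / 96)) & 0 < b.
  eexists; first reflexivity.
  by rewrite subr_gt0 -[ltRHS]expR0 ltr_expR oppr_lt0 divr_gt0 ?expR_gt0.
have c0 : 0 < 1024^-1 :> R by rewrite invr_gt0 ltr0n.
exists (1024^-1 * (a * b)); first exact: mulr_gt0 c0 (mulr_gt0 a0 b0).
move=> d p q s d45 p12 qE sE.
suff risk : ((1024^-1 * (a * b))%:E <= mle_risk p s (@e1 R d))%E.
  split=> //; apply: le_trans risk _; apply: ereal_sup_ubound; exists e1 => //.
  case: d d45 {sE} p12 => // n _ /andP[p1 _]; apply: lpball_e1.
  apply: lt_le_trans p1; rewrite ltr_wpDr// invr_ge0 addr_ge0// ln_ge0// ler1n//.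
case: d d45 p12 sE => // n d45 p12 sE.
have L0 : 0 <= ln n.+1%:R :> R by rewrite ln_ge0// ler1n.
have [p1 q2 qL qp] := dual_exponent_bounds _ _ _ L0 p12 qE.
have p12' : 1 < p <= 2 by rewrite p1/=; case/andP: p12.
have Z0 : 0 < Num.sqrt q * n.+1%:R `^ q^-1.
  by rewrite mulr_gt0 ?powR_gt0// sqrtr_gt0; lra.
have s0 : 0 < s by apply: lt_le_trans sE; rewrite divr_gt0.
have X10 : 10 <= s * (Num.sqrt q * n.+1%:R `^ q^-1) by rewrite -ler_pdivrMr.
pose A : set R := `[1 + s * - 100^-1, 1 + s * 100^-1]%classic.
pose G : set R := [set x | s * Num.sqrt q <= `|x|].
have mG : measurable G by exact: measurable_le_normr.
pose pG := fine (normal_prob 0 s G).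
have pGE : normal_prob 0 s G = pG%:E by rewrite fineK// fin_num_measure.
have pG1 : pG <= 1 by rewrite -lee_fin -pGE probability_le1.
have pGge : 12^-1 * expR (- q) <= pG.
  have := normal_prob_tail_ge s (Num.sqrt q) s0 (sqrtr_ge0 _).
  by rewrite pGE lee_fin sqr_sqrtr//; lra.
have pG0 : 0 <= pG by apply: le_trans pGge; rewrite mulr_ge0 ?expR_ge0.
(* The threshold [n * pG / 4] is half of the Chernoff exponent [n * pG / 2], so the failure
   probability is at most [expR (- (n * pG / 4))]. *)
have [||||E [mE PE EP]] := prod_probability_card_ge n
  (fun i : 'I_n.+1 => normal_prob (@e1 R n.+1 ord0 i) s) A G pG (n%:R * pG / 4).
- exact: measurable_itv.
- exact: mG.
- by rewrite pG0.
- by move=> j; rewrite mxE/= pGE.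
(* The first coordinate is not counted; passing from [n] to [d = n.+1] costs a factor 2, which turns
   1/12 into 1/24 in [npG]. *)
have n2 : n.+1%:R <= 2 * n%:R :> R.
  by rewrite -natrM ler_nat -addn1 mul2n -addnn leq_add2l (leq_trans _ (d45 : (44 <= n)%N)).
have d0 : 0 < n.+1%:R :> R by rewrite ltr0n.
(* From [q <= 2 + ln d]: the expected number [n * pG] of large coordinates is then at least
   [expR (-2) / 24], uniformly in [d] and [p]. *)
have qd : expR (-2) <= n.+1%:R * expR (- q).
  rewrite -[X in _ <= X * _](@lnK R) ?posrE// -expRD ler_expR; lra.
have npG : n.+1%:R * expR (- q) / 24 <= n%:R * pG.
  have := ler_wpM2l (ler0n R n) pGge; have := expR_gt0 (- q); nra.
rewrite /mle_risk unlock.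
apply: (@le_trans _ _ (1024^-1%:E * gaussian e1 s E)%E); last first.
  apply: ge0_integral_ge; [exact: mE|exact: ltW| |].
    by move=> w; rewrite lee_fin sqr_ge0.
  move=> w /EP[+ wS]; rewrite /A/= in_itv/= => w0; rewrite lee_fin.
  apply: (projection_error_ge n p q s w p12' q2 qp s0 X10).
    by rewrite ler_norml; lra.
  have -> : [set j : 'I_n | s * Num.sqrt q <= `|tnth w (lift ord0 j)|]%SET =
            [set j : 'I_n | tnth w (lift ord0 j) \in G]%SET.
    by apply/setP => j; rewrite !inE; apply/idP/idP; rewrite inE.
  apply: le_trans wS; lra.
rewrite EFinM; apply: lee_wpmul2l; first exact: ltW.
apply: le_trans PE; rewrite EFinM.
apply: lee_pmul; [exact: ltW|exact: ltW| |].
  rewrite mxE/= aE; apply: (normal_prob_itv_ge 1 s (- 100^-1)) => //.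
  - by lra.
  - by rewrite normrN ger0_norm.
  - by rewrite ger0_norm.
rewrite lee_fin bE lerD2l lerN2 ler_expR.
lra.
Qed.
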